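(* Let $\mathcal{H}$ be an infinite-dimensional separable Hilbert space and let $\Phi=\{\varphi_n\}_{n\in\mathbb{N}}$ be a frame for $\mathcal{H}$ with frame bounds $0<A\leq B<\infty$. Suppose further that there is a constant $c>0$ such that $\|\varphi_n\|\geq c$ for every $n\in\mathbb{N}$. Then for every $\delta>0$ there exist $f,g\in\mathcal{H}$ such that $\inf_{|\alpha|=1}\|f-\alpha g\|\geq 1$ but $\|\mathcal{A}_{\Phi}(f)-\mathcal{A}_{\Phi}(g)\|<\delta$.
   Context: The Hilbert space $\mathcal{H}$ is over $\mathbb{R}$ or $\mathbb{C}$. A countable family $\Phi=\{\varphi_n\}_{n\in I}\subseteq\mathcal{H}$ is a frame for $\mathcal{H}$ with frame bounds $0<A\le B<\infty$ if $A\|f\|^2\leq\sum_{n\in I}|\langle f,\varphi_n\rangle|^2\leq B\|f\|^2$ for every $f\in\mathcal{H}$. The (nonlinear) map $\mathcal{A}_{\Phi}:\mathcal{H}\to\ell^2(I)$ is $\mathcal{A}_{\Phi}(f)=(|\langle f,\varphi_n\rangle|)_{n\in I}$. The norm of $\mathcal{A}_{\Phi}(f)-\mathcal{A}_{\Phi}(g)$ is the $\ell^2(I)$ norm. The infimum over $|\alpha|=1$ is over unimodular elements $\alpha$ of the scalar field of $\mathcal{H}$. *)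

(* Defs.v *)
From HB Require Import structures.
From mathcomp Require Import all_boot all_order all_algebra complex.
From mathcomp Require Import all_classical all_reals all_analysis.
Set Implicit Arguments.
Unset Strict Implicit.
Unset Printing Implicit Defensive.
Import Order.TTheory GRing.Theory Num.Theory numFieldNormedType.Exports.

Local Open Scope classical_set_scope.
Local Open Scope ring_scope.

Variant base_field := over_R | over_C.

Definition scalar_field (R : realType) (k : base_field) : numFieldType :=
  match k with over_R => R | over_C => R[i] end.

Definition scalar_conj (R : realType) (k : base_field) :
    {rmorphism scalar_field R k -> scalar_field R k} :=
  match k with over_R => @idfun R | over_C => @Num.conj R[i] end.

Definition scalar_re (R : realType) (k : base_field) : scalar_field R k -> R :=
  match k with over_R => idfun | over_C => @complex.Re R end.

(* The library's norm on a normed module over a field K takes its values in K,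
   hence in R[i] when K = R[i]; rnorm is the same norm as an element of R. Since
   K is a normed module over itself, rnorm is also the modulus of a scalar. *)
Definition rnorm (R : realType) (k : base_field)
    (V : normedZmodType (scalar_field R k)) (x : V) : R := scalar_re `|x|.

(* The inner product is linear in the first argument and conjugate linear in
   the second one; inner_normE says that the norm for which the space is
   complete is the one that the inner product induces. *)
Record hilbertSpace (R : realType) (k : base_field) := HilbertSpace {
  hilbert_sort :> completeNormedModType (scalar_field R k);
  inner : {dot hilbert_sort for scalar_conj R k};
  inner_normE : forall x : hilbert_sort, inner x x = `|x| ^+ 2 }.

Definition finite_dimensional (K : numFieldType) (V : lmodType K) : Prop :=
  exists (n : nat) (e : 'I_n -> V), forall v : V,
    exists a : 'I_n -> K, v = \sum_(i < n) a i *: e i.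

Definition separable_space (T : topologicalType) : Prop :=
  exists2 D : set T, countable D & dense D.

(* The sums below are taken in \bar R, where a series with nonnegative terms
   always has a value, possibly +oo. *)
Definition is_frame (R : realType) (k : base_field) (H : hilbertSpace R k)
    (A B : R) (phi : nat -> H) : Prop :=
  [/\ 0 < A, A <= B &
    forall f : H,
      ((A * rnorm f ^+ 2)%:E <=
         \sum_(0 <= n <oo) (rnorm (inner H f (phi n)) ^+ 2)%:E)%E /\
      (\sum_(0 <= n <oo) (rnorm (inner H f (phi n)) ^+ 2)%:E <=
         (B * rnorm f ^+ 2)%:E)%E].

Definition analysis_map (R : realType) (k : base_field) (H : hilbertSpace R k)
    (phi : nat -> H) (f : H) : nat -> R :=
  fun n => rnorm (inner H f (phi n)).

(* The l^2 norm, which is +oo on the sequences that are not in l^2. *)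
Definition l2norm (R : realType) (u : nat -> R) : \bar R :=
  'N[counting]_2%:E [EFin \o u]%E.

(* Main.v *)
Require Import Defs.
From HB Require Import structures.
From mathcomp Require Import all_boot all_order all_algebra complex ring.
From mathcomp Require Import all_classical all_reals all_analysis.
Set Implicit Arguments.
Unset Strict Implicit.
Unset Printing Implicit Defensive.
Import Order.TTheory GRing.Theory Num.Theory numFieldNormedType.Exports.

Local Open Scope classical_set_scope.
Local Open Scope ring_scope.

(** Take orthogonal unit vectors [u] and [v], and put [f = v + u], [g = v - u].
    Every [f - alpha g] is [(1 - alpha) v + (1 + alpha) u], of norm at least 1,
    while the n-th entries of the two phaseless measurements differ by at most
    [2 |<u, phi_n>|], and agree when [<v, phi_n> = 0]. The upper frame bound
    makes the tails of [sum |<u, phi_n>|^2] small, so it suffices to fix [u],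
    choose [N] with a small enough tail, and take [v] orthogonal to [u] and to
    [phi_0, ..., phi_{N-1}], which is possible in infinite dimension. *)

Section ScalarRe.
Context {R : realType} {k : base_field}.
Implicit Types (a b : scalar_field R k) (V : normedZmodType (scalar_field R k)).

Lemma scalar_reD a b : scalar_re (a + b) = scalar_re a + scalar_re b.
Proof. by case: k a b => //= -[? ?] [? ?]. Qed.

Lemma scalar_re0 : scalar_re (0 : scalar_field R k) = 0.
Proof. by case: k. Qed.

Lemma scalar_re1 : scalar_re (1 : scalar_field R k) = 1.
Proof. by case: k. Qed.

(** In [R[i]] two elements are comparable only when their imaginary parts agree, and then the real
    parts decide. *)
Lemma le_scalar_re a b : a <= b -> scalar_re a <= scalar_re b.
Proof. by case: k a b => //= a b; rewrite lecE => /andP[]. Qed.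

Lemma rnorm_ge0 V (x : V) : 0 <= rnorm x.
Proof. by rewrite -scalar_re0 le_scalar_re. Qed.

Lemma rnormN V (x : V) : rnorm (- x) = rnorm x.
Proof. by rewrite /rnorm normrN. Qed.

Lemma ler_rnormD V (x y : V) : rnorm (x + y) <= rnorm x + rnorm y.
Proof. by rewrite /rnorm -scalar_reD le_scalar_re// ler_normD. Qed.

Lemma rnorm_dist_addsub V (x y : V) :
  `|rnorm (x + y) - rnorm (x - y)| <= rnorm y *+ 2.
Proof.
(* One-sided bound for every [z]: [z = y] and [z = - y] give the two halves of the absolute
   value. *)
have h z : rnorm (x + z) - rnorm (x - z) <= rnorm z *+ 2.
  rewrite lerBlDl {1}(_ : x + z = x - z + (z + z)); last first.
    by rewrite addrA subrK.
  by rewrite mulr2n (le_trans (ler_rnormD _ _))// lerD2l ler_rnormD.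
rewrite ler_norml h andbT -[leRHS]opprB lerN2.
by have := h (- y); rewrite opprK rnormN.
Qed.

End ScalarRe.

Section Hilbert.
Context {R : realType} {k : base_field} (H : hilbertSpace R k).
Implicit Types (u v w : H) (a b : scalar_field R k).

Lemma inner_eq0 u : inner H u u = 0 -> u = 0.
Proof. by rewrite inner_normE => /eqP; rewrite sqrf_eq0 normr_eq0 => /eqP. Qed.

Lemma innerZl a u v : inner H (a *: u) v = a * inner H u v.
Proof. exact: linearZl_LR. Qed.

Lemma innerZr a u v : inner H u (a *: v) = scalar_conj R k a * inner H u v.
Proof. exact: linearZr_LR. Qed.

Lemma pythagoras u v :
  inner H u v = 0 -> `|u + v| ^+ 2 = `|u| ^+ 2 + `|v| ^+ 2.
Proof. by move=> uv0; rewrite -!inner_normE hnormDd. Qed.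

(** Gram-Schmidt: subtracting a multiple of the residual [w] of [e n] from the residual [v'] of [v]
    keeps the orthogonality to the earlier vectors, and [t] makes the result orthogonal to [w],
    hence to [e n]. *)
Lemma orthogonal_projection (e : nat -> H) (n : nat) v :
  exists a : nat -> scalar_field R k, forall j, (j < n)%N ->
    inner H (v - \sum_(i < n) a i *: e i) (e j) = 0.
Proof.
elim: n v => [v|n IHn v]; first by exists (fun=> 0).
have [a va] := IHn v; have [b eb] := IHn (e n).
set w := e n - _ in eb; set v' := v - _ in va.
(* If [e n] depends on the previous vectors, then [w = 0] and the division by
   zero gives [t = 0]. *)
pose t := inner H v' w / inner H w w.
exists (fun i => if (i < n)%N then a i - t * b i else t).
rewrite big_ord_recr/= ltnn.
rewrite (eq_bigr (fun i : 'I_n => a i *: e i - t *: (b i *: e i))); last first.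
  by move=> i _; rewrite ltn_ord scalerBl scalerA.
rewrite sumrB -scaler_sumr.
have -> : v - (\sum_(i < n) a i *: e i - t *: (\sum_(i < n) b i *: e i)
    + t *: e n) = v' - t *: w.
  by rewrite /v' /w scalerBr !opprD !opprK !addrA [RHS]addrAC.
have orth j : (j < n)%N -> inner H (v' - t *: w) (e j) = 0.
  by move=> jn; rewrite linearBl /= innerZl va// eb// mulr0 subr0.
have orthw : inner H (v' - t *: w) w = 0.
  rewrite linearBl /= innerZl.
  have [w0|w0] := eqVneq (inner H w w) 0; last by rewrite divfK// subrr.
  by rewrite (inner_eq0 w0) !linear0r subr0.
move=> j; rewrite ltnS leq_eqVlt => /predU1P[->|]; last exact: orth.
have -> : e n = w + \sum_(i < n) b i *: e i by rewrite subrK.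
rewrite linearDr /= orthw add0r linear_sumr big1// => i _.
by rewrite /= innerZr orth// mulr0.
Qed.

(** Otherwise every residual of the projection vanishes, so the first [n] vectors span [H]. *)
Lemma exists_orthogonal_unit (e : nat -> H) (n : nat) :
  ~ finite_dimensional H ->
  exists2 v : H, `|v| = 1 & forall j, (j < n)%N -> inner H v (e j) = 0.
Proof.
move=> Hinf; apply: contra_notP Hinf => noU.
exists n, (fun i => e i) => v.
have [a va] := orthogonal_projection e n v; exists (fun i => a i).
apply/eqP; rewrite -subr_eq0; apply/negP => /negP v0; apply: noU.
set w := v - _ in va v0.
exists (`|w|^-1 *: w); last by move=> j jn; rewrite innerZl va// mulr0.
by rewrite normrZ normfV normr_id mulVf// normr_eq0.
Qed.

(** The squared norm is [s ^+ 2 + t ^+ 2], at least half of [(s + t) ^+ 2], and [s + t] is at least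
    2. *)
Lemma norm_addsub_ge1 u v a : `|u| = 1 -> `|v| = 1 -> inner H v u = 0 ->
  1 <= `|(v + u) - a *: (v - u)|.
Proof.
move=> u1 v1 vu0.
have -> : v + u - a *: (v - u) = (1 - a) *: v + (1 + a) *: u.
  by rewrite scalerBr scalerBl scalerDl !scale1r opprD opprK addrACA.
rewrite -(@ler_pXn2r _ 2)// ?nnegrE// expr1n pythagoras; last first.
  by rewrite innerZl innerZr vu0 !mulr0.
rewrite !normrZ u1 v1 !mulr1; set s := `|1 - a|; set t := `|1 + a|.
have st : 2 <= s + t.
  have := ler_normD (1 - a) (1 + a).
  by rewrite addrACA addNr addr0 -[1 + 1]/(2%:R) normr_nat.
(* Over the complex numbers a square may fail to be nonnegative; [s] and [t] are norms, hence
   real. *)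
have dst : 0 <= (s - t) ^+ 2.
  by rewrite real_exprn_even_ge0// rpredB// normr_real.
have e2 : (s ^+ 2 + t ^+ 2) *+ 2 = (s + t) ^+ 2 + (s - t) ^+ 2.
  by ring.
rewrite -(@ler_pMn2r _ 2)// e2 ler_wpDr//.
rewrite (@le_trans _ _ (2 ^+ 2))//; first by rewrite -natrX ler_nat.
by rewrite lerXn2r// nnegrE addr_ge0//; exact: normr_ge0.
Qed.

End Hilbert.

Lemma l2norm_lt (R : realType) (w : nat -> R) (d : R) : 0 < d ->
  (\sum_(0 <= n <oo) (w n ^+ 2)%:E < (d ^+ 2)%:E)%E -> (l2norm w < d%:E)%E.
Proof.
move=> d0 wd; rewrite /l2norm Lnorm_counting//.
rewrite (eq_eseriesr (g := fun n => (w n ^+ 2)%:E)); last first.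
  by move=> n _; rewrite /= powR_mulrn// real_normK// num_real.
move: wd; have : (0 <= \sum_(0 <= n <oo) (w n ^+ 2)%:E)%E.
  by apply: nneseries_ge0 => n _ _; rewrite lee_fin sqr_ge0.
case: (\sum_(_ <= _ <oo) _)%E => // s; rewrite !lee_fin !lte_fin => s0 sd.
rewrite powR12_sqrt//.
by rewrite -(ger0_norm (ltW d0)) -sqrtr_sqr ltr_sqrt// exprn_gt0.
Qed.

Theorem theorem2p2 (R : realType) (k : base_field) (H : hilbertSpace R k)
    (H_infinite_dimensional : ~ finite_dimensional H)
    (H_separable : separable_space H)
    (phi : nat -> H) (A B : R) (phi_frame : is_frame A B phi)
    (c : R) (c_gt0 : 0 < c) (phi_ge : forall n : nat, c <= rnorm (phi n))
    (delta : R) (delta_gt0 : 0 < delta) :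
  exists f g : H,
    1 <= inf [set rnorm (f - alpha *: g)
             | alpha in [set alpha : scalar_field R k | `|alpha| = 1]] /\
    (l2norm (analysis_map phi f \- analysis_map phi g)%R < delta%:E)%E.
Proof.
have [u u1 _] := exists_orthogonal_unit phi 0 H_infinite_dimensional.
(* [q n] bounds the square of the n-th entry of the difference whatever [v] is; its sum is at most
   [4 * B * rnorm u ^+ 2]. *)
pose q n := ((rnorm (inner H u (phi n)) *+ 2) ^+ 2)%:E.
have q_ge0 n : (0 <= q n)%E by rewrite lee_fin sqr_ge0.
have q_lty : (\sum_(0 <= n <oo) q n < +oo)%E.
  have [_ _ /(_ u)[_ uB]] := phi_frame.
  rewrite (eq_eseriesr (g := fun n =>
    4%:E * (rnorm (inner H u (phi n)) ^+ 2)%:E)%E); last first.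
    by move=> n _; rewrite -EFinM /q; congr EFin; ring.
  rewrite nneseriesZl; last by move=> n _; rewrite lee_fin sqr_ge0.
  rewrite (le_lt_trans (lee_wpmul2l _ uB)) ?lee_fin//.
  by rewrite -EFinM ltry.
have [N tailN] : exists N, (\sum_(N <= n <oo) q n < (delta ^+ 2)%:E)%E.
  have /(_ [set x | (x < (delta ^+ 2)%:E)%E])[|N _ hN] :=
    nneseries_tail_cvg q_lty (fun n _ => q_ge0 n).
    by apply: open_nbhs_nbhs; split;
      [exact: open_ereal_lt_ereal | rewrite /= lte_fin exprn_gt0].
  by exists N; apply: hN => /=.
(* With [u] put in front of [phi], the first [N.+1] vectors are [u] and the first [N] frame
   vectors. *)
pose e n := if n is n'.+1 then phi n' else u.
have [v v1 ve] := exists_orthogonal_unit e N.+1 H_infinite_dimensional.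
exists (v + u), (v - u); split.
  apply: lb_le_inf.
    by exists (rnorm (v + u - 1 *: (v - u))); exists 1; rewrite //= normr1.
  move=> _ [a _ <-]; rewrite -(@scalar_re1 R k); apply: le_scalar_re.
  by apply: norm_addsub_ge1 => //; exact: (ve 0).
apply: l2norm_lt => //; apply: le_lt_trans tailN.
(* For [n < N] the entries are the moduli of opposite scalars and cancel; the remaining terms are
   bounded by [q n]. *)
rewrite (nneseries_split 0 N); last by move=> n _; rewrite lee_fin sqr_ge0.
rewrite add0n big_nat big1 ?add0e => [|n /= nN]; last first.
  rewrite /analysis_map linearDl linearBl /= (ve n.+1)//.
  by rewrite add0r sub0r rnormN subrr expr0n.
apply: lee_nneseries => [n _ _|n _]; first by rewrite lee_fin sqr_ge0.
rewrite lee_fin /analysis_map /= linearDl linearBl /= -real_normK ?num_real//.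
by rewrite lerXn2r ?nnegrE ?mulrn_wge0 ?rnorm_ge0// rnorm_dist_addsub.
Qed.
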